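(* Let $\mathcal{F}=\{A_1,\ldots,A_m\}\subset\mathbb{R}^{n\times n}$ be a family of (entrywise) nonnegative matrices. If there exist an integer $j\ge1$ and a product $A_{i_1}A_{i_2}\cdots A_{i_j}\in\mathcal{F}_j$ that is primitive, then $$\rho(\mathcal{F})=\lim_{k\to\infty}\rho(\mathsf{P}(\mathcal{F}_k))^{1/k}.$$
   Context: For a finite set $\mathcal{F}=\{A_1,\ldots,A_m\}$ of complex $n\times n$ matrices and $k\ge 1$, let $\mathcal{F}_k=\{A_{i_1}A_{i_2}\cdots A_{i_k}: 1\le i_j\le m\}$ be the set of all products of length $k$. The joint (equivalently, generalized) spectral radius of a finite set $\mathcal{F}$ is $\rho(\mathcal{F})=\lim_{k\to\infty}\max_{A\in\mathcal{F}_k}\|A\|^{1/k}=\limsup_{k\to\infty}\max_{A\in\mathcal{F}_k}\rho(A)^{1/k}$, where $\|\cdot\|$ is any sub-multiplicative matrix norm and $\rho(A)$ is the spectral radius of a matrix $A$ (the two expressions are known to coincide for finite sets). Rank-one approximation: for $A\in\mathbb{C}^{n\times n}$ take a singular value decomposition $A=\sum_{i=1}^n\sigma_iu_iv_i^*$, with $\sigma_1\ge\cdots\ge\sigma_n\ge0$ the singular values and $u_i$, $v_i$ the $i$-th left and right singular vectors ($\{u_i\}$ and $\{v_i\}$ orthonormal bases). Define $\mathsf{P}(A)=\sigma_{i'}u_{i'}v_{i'}^*$, where $i'$ is an index maximizing $|\mathrm{tr}(\sigma_iu_iv_i^* )|=\rho(\sigma_iu_iv_i^* )$ over $1\le i\le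 n$. (For each matrix $A$ an arbitrary choice of singular value decomposition and of maximizing index is fixed.) For a finite set $\mathcal{G}$ of matrices, $\mathsf{P}(\mathcal{G})=\{\mathsf{P}(A): A\in\mathcal{G}\}$; thus $\rho(\mathsf{P}(\mathcal{F}_k))$ is the joint spectral radius of the finite set $\mathsf{P}(\mathcal{F}_k)$. A square matrix $A\ge0$ (entrywise) is primitive if $A^{\ell}>0$ (entrywise) for some integer $\ell\ge1$. *)

(* Defs.v *)
From HB Require Import structures.
From mathcomp Require Import all_boot all_order all_algebra.
From mathcomp Require Import finmap complex.
From mathcomp Require Import all_classical all_reals all_analysis.

Set Implicit Arguments.
Unset Strict Implicit.
Unset Printing Implicit Defensive.

Import Order.TTheory GRing.Theory Num.Theory.
Import numFieldNormedType.Exports.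

Local Open Scope fset_scope.
Local Open Scope complex_scope.
Local Open Scope sesquilinear_scope.
Local Open Scope ring_scope.

(* `mprods F k` is the set F_k of all products of length k of elements of F,
   with F_0 = {1}. *)
Fixpoint mprods (K : pzRingType) (n : nat) (F : {fset 'M[K]_n}) (k : nat) :
    {fset 'M[K]_n} :=
  if k is k'.+1 then [fset A *m B | A in F, B in mprods F k'] else [fset 1%:M].

Definition cplx_set (R : realType) (n : nat) (F : {fset 'M[R]_n}) :
    {fset 'M[R[i]]_n} :=
  [fset map_mx (real_complex R) A | A in F].

Definition nonneg_mx (R : realType) (n : nat) (A : 'M[R]_n) : Prop :=
  forall i j, 0 <= A i j.

Definition pos_mx (R : realType) (n : nat) (A : 'M[R]_n) : Prop :=
  forall i j, 0 < A i j.

Definition mxpow (K : pzRingType) (n : nat) (A : 'M[K]_n) (l : nat) : 'M[K]_n :=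
  iter l (mulmx A) 1%:M.

Definition primitive_mx (R : realType) (n : nat) (A : 'M[R]_n) : Prop :=
  nonneg_mx A /\ exists2 l : nat, (1 <= l)%N & pos_mx (mxpow A l).

(* A norm on the complex vector space of n x n matrices; absolute homogeneity
   is stated in R[i] because the modulus there takes its values in R[i]. *)
Record submult_norm (R : realType) (n : nat) (N : 'M[R[i]]_n -> R) : Prop := {
  submult_norm_ge0 : forall A, 0 <= N A;
  submult_norm_eq0 : forall A, N A = 0 -> A = 0;
  submult_normZ : forall a A, (N (a *: A))%:C = `|a| * (N A)%:C;
  submult_normD : forall A B, N (A + B) <= N A + N B;
  submult_normM : forall A B, N (A *m B) <= N A * N B
}.

(* The joint spectral radius lim_k max_{A in F_k} N(A)^(1/k), computed with the
   norm N.  For a submultiplicative norm the limit exists by Fekete's lemma and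
   does not depend on N. The empty family gets the value 0. *)
Definition jsr (R : realType) (n : nat) (N : 'M[R[i]]_n -> R)
    (F : {fset 'M[R[i]]_n}) : R :=
  limn (fun k : nat =>
    (\big[Num.max/0]_(A <- mprods F k) N A) `^ (k%:R^-1)).

Definition svd_term (R : realType) (n : nat) (U : 'M[R[i]]_n)
    (sigma : 'I_n -> R) (V : 'M[R[i]]_n) (i : 'I_n) : 'M[R[i]]_n :=
  (sigma i)%:C *: (col i U *m (col i V)^t*).

(* The singular vectors u_i and v_i are the columns of the unitary matrices
   U and V. *)
Record is_svd (R : realType) (n : nat) (A U : 'M[R[i]]_n)
    (sigma : 'I_n -> R) (V : 'M[R[i]]_n) : Prop := {
  svd_left_unitary : U \is unitarymx;
  svd_right_unitary : V \is unitarymx;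
  svd_values_ge0 : forall i, 0 <= sigma i;
  svd_values_sorted : forall i j : 'I_n, (i <= j)%N -> sigma j <= sigma i;
  svd_sum : A = \sum_i svd_term U sigma V i
}.

(* `B` is an admissible value of P(A), for some singular value decomposition of
   A and some maximizing index. *)
Definition rank_one_approx (R : realType) (n : nat) (A B : 'M[R[i]]_n) : Prop :=
  exists (U : 'M[R[i]]_n) (sigma : 'I_n -> R) (V : 'M[R[i]]_n) (i' : 'I_n),
    [/\ is_svd A U sigma V,
        (forall i, `|\tr (svd_term U sigma V i)|
                     <= `|\tr (svd_term U sigma V i')|) &
        B = svd_term U sigma V i'].

(* Main.v *)
(* Write [M k] for the largest norm of a product of length k, so that
   [M k ^ (1/k)] tends to rho(F) by Fekete's lemma.  It is enough to compare
   [g k = rho(P(F_k))] with [M k] up to constants, since k-th roots of constants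
   tend to 1.  Above: [P A] is [A] compressed between two rank-one projections,
   so [N (P A) <= C * N A].  Below: for a rank-one [B], [tr (B^k) = (tr B)^k], so
   [|tr B|] is at most the joint spectral radius of any set containing [B], while
   [|tr A| <= n * |tr (P A)|]; and if [D > 0] is a product of length m, then
   [tr (D A)] dominates all entries of a nonnegative [A], so that
   [M k <= c * g (m + k)], whence [M k <= c' * g k] by submultiplicativity. *)

Require Import Defs.
From HB Require Import structures.
From mathcomp Require Import all_boot all_order all_algebra.
From mathcomp Require Import finmap complex.
From mathcomp Require Import all_classical all_reals all_analysis.
Import Order.TTheory GRing.Theory Num.Theory.
Import numFieldNormedType.Exports.
Local Open Scope classical_set_scope.
Local Open Scope fset_scope.
Local Open Scope complex_scope.
Local Open Scope sesquilinear_scope.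
Local Open Scope ring_scope.

(** * Real [k]-th roots and the disappearance of constants in the limit *)

Lemma powR_rootK {R : realType} (x : R) (k : nat) :
  0 <= x -> (0 < k)%N -> (x ^+ k) `^ k%:R^-1 = x.
Proof.
move=> x0 k0; rewrite -powR_mulrn// -powRrM mulfV ?powRr1//.
by rewrite pnatr_eq0 -lt0n.
Qed.

Lemma powR_root_exprn {R : realType} (x : R) (k : nat) :
  0 <= x -> (0 < k)%N -> (x `^ k%:R^-1) ^+ k = x.
Proof.
move=> x0 k0; rewrite -powR_mulrn ?powR_ge0// -powRrM mulVf ?powRr1//.
by rewrite pnatr_eq0 -lt0n.
Qed.

Lemma ler_powR_root {R : realType} (x y : R) (k : nat) :
  0 <= x -> x <= y -> x `^ k%:R^-1 <= y `^ k%:R^-1.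
Proof.
move=> x0 xy; apply: ge0_ler_powR => //; rewrite ?nnegrE ?invr_ge0//.
exact: le_trans xy.
Qed.

Lemma cvg_root_cst {R : realType} (c : R) : 0 < c ->
  (fun k : nat => c `^ k%:R^-1) @ \oo --> (1 : R).
Proof.
(* After the shift the sequence is [expR] of [ln c] times the harmonic sequence. *)
move=> c0; rewrite -cvg_shiftS.
have -> : (fun k : nat => c `^ k.+1%:R^-1) =
    (fun k : nat => expR (k.+1%:R^-1 * ln c)).
  by apply/funext => k; rewrite /powR gt_eqF.
have h : (fun k : nat => k.+1%:R^-1 * ln c) @ \oo --> 0 * ln c.
  by apply: cvgMl; exact: cvg_harmonic.
rewrite mul0r in h.
have : (fun k : nat => expR (k.+1%:R^-1 * ln c)) @ \oo --> expR (0 : R).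
  by apply: continuous_cvg => //; exact: continuous_expR.
by rewrite expR0.
Qed.

Lemma cvg_root_scale {R : realType} (u : nat -> R) (c L : R) :
  0 < c -> (forall k, 0 <= u k) ->
  (fun k => u k `^ k%:R^-1) @ \oo --> L ->
  (fun k => (c * u k) `^ k%:R^-1) @ \oo --> L.
Proof.
move=> c0 u0 uL.
have -> : (fun k => (c * u k) `^ k%:R^-1) =
    (fun k => c `^ k%:R^-1 * u k `^ k%:R^-1).
  by apply/funext => k; rewrite powRM// ltW.
by rewrite -[L]mul1r; apply: cvgM => //; exact: cvg_root_cst.
Qed.

(** * Fekete's lemma in multiplicative form *)

Section Fekete.
Context {R : realType} (u : nat -> R).
Hypothesis u_ge0 : forall k, 0 <= u k.
Hypothesis u_submul : forall k l, u (k + l)%N <= u k * u l.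

Lemma submul_expr k q r : u (q * k + r)%N <= u k ^+ q * u r.
Proof.
elim: q => [|q IH]; first by rewrite expr0 mul1r.
rewrite mulSn -addnA; apply: (le_trans (u_submul _ _)).
by rewrite exprS -mulrA ler_wpM2l.
Qed.

(** Division of [k] by [p] with quotient [q] and remainder [r] gives [u k <= u p ^+ q * u r], which
    is at most [b ^+ k * (u r / b ^+ r)]. The sum in the witness dominates this last factor for
    every remainder; the added 1 makes it positive. *)
Lemma submul_geometric_bound (p : nat) (b : R) :
  (0 < p)%N -> 0 < b -> u p <= b ^+ p ->
  exists2 C : R, 0 < C & forall k, u k <= C * b ^+ k.
Proof.
move=> p0 b0 upb.
have t0 r : 0 <= u r / b ^+ r by rewrite divr_ge0// exprn_ge0// ltW.
exists (1 + \sum_(r < p) u r / b ^+ r).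
  by rewrite ltr_wpDr// sumr_ge0.
move=> k; rewrite {1}(divn_eq k p); apply: (le_trans (submul_expr _ _ _)).
rewrite {3}(divn_eq k p) exprD mulnC exprM mulrCA ler_pM ?exprn_ge0//.
  by rewrite lerXn2r ?nnegrE ?exprn_ge0// ltW.
rewrite -ler_pdivrMr ?exprn_gt0//.
rewrite (bigD1 (Ordinal (ltn_pmod k p0)))//= addrCA lerDl.
by rewrite addr_ge0// sumr_ge0.
Qed.

(** The limit is the infimum of the roots: a single index [p] whose root is close to it controls all
    large indices through a geometric bound. *)
Lemma submul_root_cvg : cvgn (fun k => u k `^ k%:R^-1).
Proof.
(* Index 0 is left out: there the exponent [0^-1 = 0] yields the value 1 whatever [u 0] is. *)
pose S := [set u k.+1 `^ k.+1%:R^-1 | k in [set: nat]]%classic.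
have S0 : (S !=set0)%classic by exists (u 1%N `^ 1%:R^-1); exists 0%N.
have lbS : has_lbound S by exists 0 => _ [k _ <-]; exact: powR_ge0.
apply: (cvgP (inf S)).
apply/cvgrPdist_le => e e0.
have [|_ [p _ <-] pe] := @inf_adherent _ S (e / 2) _ (conj S0 lbS).
  by rewrite divr_gt0.
set b := inf S + e / 2 in pe.
have b0 : 0 < b by apply: le_lt_trans pe; exact: powR_ge0.
have [||C C0 uC] := @submul_geometric_bound p.+1 b _ b0 => //.
  rewrite -[u _](@powR_root_exprn _ _ p.+1)// lerXn2r ?nnegrE ?powR_ge0 ?ltW//.
have Cb : (fun k : nat => C `^ k%:R^-1 * b) @ \oo --> 1 * b.
  by apply: cvgMl; exact: cvg_root_cst.
rewrite mul1r in Cb.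
(* Half of [e] was spent on choosing [p]; the other half absorbs the root of [C]. *)
have nearb : \forall k \near \oo, C `^ k%:R^-1 * b <= b + e / 2.
  by apply: (cvgr_le _ Cb); rewrite ltrDl divr_gt0.
near=> k.
have k0 : (0 < k)%N by near: k; exists 1%N.
rewrite ler_distlC; apply/andP; split.
  apply: (@le_trans _ _ (inf S)); first by rewrite gerBl ltW.
  by apply: ge_inf => //; exists k.-1 => //; rewrite prednK.
apply: (@le_trans _ _ (C `^ k%:R^-1 * b)).
  apply: (le_trans (ler_powR_root _ _ k (u_ge0 k) (uC k))).
  have b0W := ltW b0; have C0W := ltW C0.
  by rewrite powRM ?exprn_ge0// powR_rootK.
apply: (@le_trans _ _ (b + e / 2)); first by near: k.
by rewrite /b -addrA -splitr.
Unshelve. all: by end_near. Qed.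

End Fekete.

(** * The complex modulus as a real number *)

Lemma normr_complexE {R : realType} (z : R[i]) : `|z| = (Normc.normc z)%:C.
Proof. by []. Qed.

Lemma normc_ge0 {R : realType} (z : R[i]) : 0 <= Normc.normc z.
Proof. by rewrite -lecR -normr_complexE normr_ge0. Qed.

Lemma normcX {R : realType} (z : R[i]) (k : nat) :
  Normc.normc (z ^+ k) = Normc.normc z ^+ k.
Proof. by apply: (@complexI R); rewrite rmorphXn /= -!normr_complexE normrX. Qed.

Lemma normc_real {R : realType} (x : R) : 0 <= x -> Normc.normc x%:C = x.
Proof.
by move=> x0; apply: (@complexI R); rewrite -normr_complexE ger0_norm ?lecR.
Qed.

Lemma ler_normc_sum {R : realType} {I : Type} (r : seq I) (F : I -> R[i]) :
  Normc.normc (\sum_(i <- r) F i) <= \sum_(i <- r) Normc.normc (F i).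
Proof.
rewrite -lecR -normr_complexE rmorph_sum /=.
exact: (le_trans (ler_norm_sum _ _ _)).
Qed.

(** * Products of given length, and nonnegative matrices *)

Section MatrixProducts.
Context {K : pzRingType} {n : nat} (F : {fset 'M[K]_n}).

Lemma mprodsS (A B : 'M[K]_n) k :
  A \in F -> B \in mprods F k -> A *m B \in mprods F k.+1.
Proof. by move=> AF BF; apply/imfset2P; exists A => //; exists B. Qed.

Lemma mprodsSP (C : 'M[K]_n) k : C \in mprods F k.+1 ->
  exists A B, [/\ A \in F, B \in mprods F k & C = A *m B].
Proof. by case/imfset2P => A AF [B BF ->]; exists A, B. Qed.

Lemma mprods_mul (A B : 'M[K]_n) k l :
  A \in mprods F k -> B \in mprods F l -> A *m B \in mprods F (k + l).
Proof.
elim: k A => [A|k IH A].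
  by rewrite inE => /eqP -> Bl; rewrite mul1mx.
case/mprodsSP => A1 [A2 [A1F A2F ->]] Bl.
by rewrite -mulmxA; apply: mprodsS => //; exact: IH.
Qed.

Lemma mprods_split (C : 'M[K]_n) k l : C \in mprods F (k + l) ->
  exists A B, [/\ A \in mprods F k, B \in mprods F l & C = A *m B].
Proof.
elim: k C => [C Cl|k IH C].
  by exists 1%:M, C; rewrite inE mul1mx.
case/mprodsSP => A1 [A2 [A1F /IH[A [B [Ak Bl ->]]] ->]].
by exists (A1 *m A), B; split=> //; [exact: mprodsS | rewrite mulmxA].
Qed.

Lemma mprods_pow (A : 'M[K]_n) k l :
  A \in mprods F k -> mxpow A l \in mprods F (l * k).
Proof.
move=> Ak; elim: l => [|l IH]; first by rewrite inE.
by rewrite mulSn; exact: mprods_mul.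
Qed.

End MatrixProducts.

(** This lets positivity be argued over the reals while norms are taken over the complex numbers. *)
Lemma mprods_cplx {R : realType} {n : nat} (F : {fset 'M[R]_n}) k
    (A : 'M[R[i]]_n) :
  reflect (exists2 B, B \in mprods F k & A = map_mx (real_complex R) B)
          (A \in mprods (cplx_set F) k).
Proof.
apply: (iffP idP).
  elim: k A => [A|k IH A].
    rewrite inE => /eqP ->; exists 1%:M; first by rewrite inE.
    by rewrite map_mx1.
  case/mprodsSP => _ [_ [/imfsetP[/= A1 A1F ->] /IH[A2 A2F ->] ->]].
  by exists (A1 *m A2); rewrite ?map_mxM//; exact: mprodsS.
case=> B + ->; elim: k B => [B|k IH B].
  by rewrite inE => /eqP ->; rewrite map_mx1 inE.
case/mprodsSP => A1 [A2 [A1F /IH A2F ->]]; rewrite map_mxM.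
by apply: mprodsS => //; apply/imfsetP; exists A1.
Qed.

Lemma mprods_nonneg {R : realType} {n : nat} (F : {fset 'M[R]_n}) k
    (A : 'M[R]_n) :
  (forall B, B \in F -> nonneg_mx B) -> A \in mprods F k -> nonneg_mx A.
Proof.
move=> F0; elim: k A => [A|k IH A].
  by rewrite inE => /eqP -> i j; rewrite mxE; case: eqP.
case/mprodsSP => A1 [A2 [/F0 A1F /IH A2F ->]] i j; rewrite mxE.
by apply: sumr_ge0 => l _; rewrite mulr_ge0.
Qed.

(** The trace is a sum of nonnegative terms, one of which is [D j i * A i j]. Summing all inverses
    of entries of [D] makes the constant independent of [i] and [j]. *)
Lemma entry_le_trace_mulmx {R : realType} {n : nat} (D : 'M[R]_n) :
  pos_mx D -> exists2 c : R, 0 < c &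
    forall A, nonneg_mx A -> forall i j, A i j <= c * \tr (D *m A).
Proof.
move=> D0; have Di i j : 0 <= (D i j)^-1 by rewrite invr_ge0 ltW.
have S0 : 0 <= \sum_i \sum_j (D i j)^-1.
  by apply: sumr_ge0 => i _; apply: sumr_ge0.
exists (1 + \sum_i \sum_j (D i j)^-1); first by rewrite ltr_wpDr.
move=> A A0 i j.
have t0 : forall k l, 0 <= D k l * A l k by move=> k l; rewrite mulr_ge0// ltW.
have tr0 : D j i * A i j <= \tr (D *m A).
  rewrite /mxtrace (bigD1 j)//= mxE (bigD1 i)//= -addrA lerDl addr_ge0//.
    by apply: sumr_ge0.
  by apply: sumr_ge0 => k _; rewrite mxE; apply: sumr_ge0.
have tge0 : 0 <= \tr (D *m A) by apply: le_trans tr0; rewrite t0.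
apply: (@le_trans _ _ ((D j i)^-1 * \tr (D *m A))).
  by rewrite ler_pdivlMl ?D0.
rewrite ler_wpM2r// (bigD1 j)//= (bigD1 i)//= addrCA -addrA lerDl.
rewrite addr_ge0//; first exact: sumr_ge0.
by rewrite addr_ge0//; apply: sumr_ge0 => k _; exact: sumr_ge0.
Qed.

(** * Powers and traces of rank-one matrices *)

Section RankOne.
Context {K : comPzRingType} {n : nat} (x : 'cV[K]_n) (y : 'rV[K]_n).

Lemma mxtrace_outer : \tr (x *m y) = (y *m x) 0 0.
Proof. by rewrite mxtrace_mulC trace_mx11. Qed.

(** By associativity each new factor contributes the 1 by 1 matrix [y *m x], whose entry is the
    trace. *)
Lemma mxpow_outer k : mxpow (x *m y) k.+1 = (\tr (x *m y)) ^+ k *: (x *m y).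
Proof.
elim: k => [|k IH]; first by rewrite /mxpow /= mulmx1 expr0 scale1r.
rewrite /mxpow iterS -/(mxpow _ k.+1) IH -scalemxAr -mulmxA (mulmxA y).
rewrite [y *m x]mx11_scalar -mxtrace_outer mul_scalar_mx -scalemxAr.
by rewrite scalerA -exprSr.
Qed.

Lemma mxtrace_mxpow_outer k :
  (0 < k)%N -> \tr (mxpow (x *m y) k) = (\tr (x *m y)) ^+ k.
Proof. by case: k => // k _; rewrite mxpow_outer mxtraceZ -exprSr. Qed.

End RankOne.

(** * Submultiplicative norms and the joint spectral radius *)

Section SubmultNorm.
Context {R : realType} {n : nat} {N : 'M[R[i]]_n -> R}.
Hypothesis N_norm : submult_norm N.

Let N_ge0 := submult_norm_ge0 N_norm.

Lemma submult_norm_scale a A : N (a *: A) = Normc.normc a * N A.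
Proof.
by apply: (@complexI R); rewrite (submult_normZ N_norm) normr_complexE -rmorphM.
Qed.

Lemma submult_norm_sum I (r : seq I) (A : I -> 'M[R[i]]_n) :
  N (\sum_(i <- r) A i) <= \sum_(i <- r) N (A i).
Proof.
apply: (big_ind2 (fun A x => N A <= x)) => //.
  by rewrite -(scale0r (0 : 'M[R[i]]_n)) submult_norm_scale Normc.normc0 mul0r.
move=> A1 x1 A2 x2 h1 h2; apply: (le_trans (submult_normD N_norm _ _)).
exact: lerD.
Qed.

(** Expansion over the matrix units, followed by the triangle inequality. *)
Lemma submult_norm_le_entries : exists2 C : R, 0 < C &
  forall (A : 'M[R[i]]_n) b, 0 <= b ->
    (forall i j, Normc.normc (A i j) <= b) -> N A <= C * b.
Proof.
have S0 : 0 <= \sum_i \sum_j N (delta_mx i j).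
  by apply: sumr_ge0 => i _; apply: sumr_ge0.
exists (1 + \sum_i \sum_j N (delta_mx i j)); first by rewrite ltr_wpDr.
move=> A b b0 Ab; rewrite {1}(matrix_sum_delta A).
apply: (@le_trans _ _ ((\sum_i \sum_j N (delta_mx i j)) * b)); last first.
  by rewrite ler_wpM2r// lerDr.
apply: (le_trans (submult_norm_sum _ _ _)); rewrite mulr_suml.
apply: ler_sum => i _; apply: (le_trans (submult_norm_sum _ _ _)).
rewrite mulr_suml; apply: ler_sum => j _.
by rewrite submult_norm_scale mulrC ler_wpM2l.
Qed.

(* [delta_mx i i *m A *m delta_mx j j = A i j *: delta_mx i j], so
   submultiplicativity alone bounds the entries. *)
Lemma entry_le_submult_norm : exists2 C : R, 0 < C &
  forall (A : 'M[R[i]]_n) i j, Normc.normc (A i j) <= C * N A.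
Proof.
pose t i j : R :=
  N (delta_mx i i) * N (delta_mx j j) / N (delta_mx i j).
have t0 i j : 0 <= t i j by rewrite !mulr_ge0// invr_ge0.
have S0 : 0 <= \sum_i \sum_j t i j.
  by apply: sumr_ge0 => i _; apply: sumr_ge0.
exists (1 + \sum_i \sum_j t i j); first by rewrite ltr_wpDr.
move=> A i j; apply: (@le_trans _ _ (t i j * N A)); last first.
  rewrite ler_wpM2r// (bigD1 i)//= (bigD1 j)//= addrCA -addrA lerDl.
  rewrite addr_ge0//; first exact: sumr_ge0.
  by rewrite addr_ge0//; apply: sumr_ge0 => k _; exact: sumr_ge0.
have Nij : 0 < N (delta_mx i j).
  rewrite lt_neqAle N_ge0 andbT eq_sym; apply/eqP => /(submult_norm_eq0 N_norm).
  move=> /matrixP/(_ i j); rewrite !mxE !eqxx => /eqP.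
  by rewrite oner_eq0.
rewrite /t mulrAC ler_pdivlMr// -submult_norm_scale.
have -> : A i j *: delta_mx i j =
    delta_mx i i *m A *m delta_mx j j :> 'M[R[i]]_n.
  apply/matrixP => k l; rewrite !mxE (bigD1 j)//= !mxE (bigD1 i)//= !mxE !eqxx.
  rewrite big1 => [|m mi]; last by rewrite !mxE (negPf mi) andbF mul0r.
  rewrite big1 => [|m mj]; last by rewrite !mxE (negPf mj) mulr0.
  rewrite !addr0 andbT /= eq_sym.
  by do 2 case: eqP; rewrite ?mulr0 ?mul0r ?mulr1 ?mul1r.
apply: (le_trans (submult_normM N_norm _ _)); rewrite mulrAC ler_wpM2r//.
exact: (submult_normM N_norm).
Qed.

Lemma trace_le_submult_norm : exists2 C : R, 0 < C &
  forall A, Normc.normc (\tr A) <= C * N A.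
Proof.
(* The trace has [n] entries; the added 1 keeps the constant positive when [n = 0]. *)
have [C C0 CN] := entry_le_submult_norm.
exists (1 + C *+ n) => [|A]; first by rewrite ltr_wpDr// mulrn_wge0 ?ltW.
apply: (le_trans (ler_normc_sum _ _)).
apply: (@le_trans _ _ (\sum_(i < n) C * N A)); first exact: ler_sum.
by rewrite sumr_const card_ord -mulrnAl ler_wpM2r// lerDr.
Qed.

(** The sequence inside [jsr], before roots are taken; Fekete's lemma is applied to it. *)
Definition prods_norm (G : {fset 'M[R[i]]_n}) (k : nat) : R :=
  \big[Num.max/0]_(A <- mprods G k) N A.

Lemma prods_norm_ge0 G k : 0 <= prods_norm G k.
Proof. exact: bigmax_ge_id. Qed.

Lemma le_prods_norm G k A : A \in mprods G k -> N A <= prods_norm G k.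
Proof. by move=> AG; exact: le_bigmax_seq. Qed.

Lemma prods_norm_le G k b : 0 <= b ->
  (forall A, A \in mprods G k -> N A <= b) -> prods_norm G k <= b.
Proof. by move=> b0 Gb; rewrite /prods_norm big_seq; exact: bigmax_le. Qed.

Lemma prods_norm_submul G k l :
  prods_norm G (k + l) <= prods_norm G k * prods_norm G l.
Proof.
apply: prods_norm_le => [|_ /mprods_split[A [B [Ak Bl ->]]]].
  by rewrite mulr_ge0 ?prods_norm_ge0.
apply: (le_trans (submult_normM N_norm _ _)).
by rewrite ler_pM ?le_prods_norm.
Qed.

Lemma jsr_cvg G :
  (fun k => prods_norm G k `^ k%:R^-1) @ \oo --> jsr N G.
Proof.
exact: (submul_root_cvg _ (prods_norm_ge0 G) (prods_norm_submul G)).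
Qed.

Lemma jsr_ge0 G : 0 <= jsr N G.
Proof.
apply: limr_ge; first by apply: cvgP; exact: jsr_cvg.
by apply: nearW => k; exact: powR_ge0.
Qed.

Lemma jsr_le G b : 0 <= b -> (forall A, A \in G -> N A <= b) -> jsr N G <= b.
Proof.
move=> b0 Gb; apply: limr_le; first by apply: cvgP; exact: jsr_cvg.
(* Only positive lengths are compared: the bound [b] says nothing about the norm of the empty
   product [1%:M]. *)
exists 1%N => // -[//|k] _; rewrite -[leRHS](powR_rootK b k.+1)//.
apply: ler_powR_root; first exact: prods_norm_ge0.
apply: prods_norm_le; first exact: exprn_ge0.
elim: k => [|k IH] A /mprodsSP[A1 [A2 [/Gb A1b A2G ->]]].
  by move: A2G; rewrite inE => /eqP ->; rewrite mulmx1 expr1.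
apply: (le_trans (submult_normM N_norm _ _)); rewrite exprS.
by rewrite ler_pM// IH.
Qed.

(** The [k]-th power of [x *m y] is a product of length [k] with trace [\tr (x *m y) ^+ k]. The norm
    bounds the trace up to a constant, which vanishes after [k]-th roots. *)
Lemma le_jsr_trace_outer G (x : 'cV[R[i]]_n) (y : 'rV[R[i]]_n) :
  x *m y \in G -> Normc.normc (\tr (x *m y)) <= jsr N G.
Proof.
move=> xyG; have [C C0 CN] := trace_le_submult_norm.
have cC := cvg_root_scale _ _ _ C0 (prods_norm_ge0 G) (jsr_cvg G).
rewrite -(cvg_lim _ cC)//; apply: limr_ge; first by apply: cvgP cC.
exists 1%N => // k /= k0.
rewrite -[leLHS](powR_rootK _ k)//; last exact: normc_ge0.
apply: ler_powR_root; first by rewrite exprn_ge0// normc_ge0.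
rewrite -normcX -mxtrace_mxpow_outer//; apply: (le_trans (CN _)).
rewrite ler_pM2l//; apply: le_prods_norm.
have xyG1 : x *m y \in mprods G 1.
  by rewrite -[_ *m _]mulmx1; apply: mprodsS; rewrite ?inE.
by have := mprods_pow G (x *m y) 1 k xyG1; rewrite muln1.
Qed.

(** [B] is [A] multiplied on the left by the projection onto [u_i'] and on the right by that onto
    [v_i']. Entries of these projections have modulus at most 1, so each costs one factor [C]. *)
Lemma submult_norm_rank_one_approx : exists2 C : R, 0 < C &
  forall A B, rank_one_approx A B -> N B <= C * N A.
Proof.
have [C C0 CN] := submult_norm_le_entries.
have col1 (U : 'M[R[i]]_n) i :
    U \is unitarymx -> N (col i U *m (col i U)^t*) <= C.
  move=> Uu; rewrite -[C]mulr1; apply: CN => // k l.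
  (* Each row of a unitary matrix has unit Euclidean length. *)
  have Ule a : `|U a i| <= 1.
    have /unitarymxP/matrixP/(_ a a) := Uu.
    rewrite !mxE eqxx mulr1n => UU; rewrite -(@expr_le1 _ 2)// normCK -{1}UU.
    rewrite (bigD1 i)//= !mxE lerDl; apply: sumr_ge0 => j _.
    by rewrite !mxE mul_conjC_ge0.
  rewrite -lecR -normr_complexE !mxE big_ord1 !mxE normrM norm_conjC.
  by rewrite mulr_ile1.
exists (C * C) => [|A B [U [s [V [i' [[Uu Vu _ _ AE] _ ->]]]]]].
  exact: mulr_gt0.
have colE (W : 'M[R[i]]_n) i j : W \is unitarymx ->
    (col i W)^t* *m col j W = (i == j)%:R%:M.
  move=> Wu; have : W^t* *m W = 1%:M by exact: mulmx1C (unitarymxP Wu).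
  move=> /matrixP/(_ i j); rewrite !mxE => WW.
  apply/matrixP => a b; rewrite !ord1 !mxE -mulr_natr mul1r -WW.
  by apply: eq_bigr => k _; rewrite !mxE.
have -> : svd_term U s V i' =
    (col i' U *m (col i' U)^t*) *m A *m (col i' V *m (col i' V)^t*).
  (* Orthonormality of the singular vectors kills every term but the one at [i']. *)
  rewrite AE mulmx_sumr mulmx_suml (bigD1 i')//= big1 => [|j ji].
    rewrite addr0 /svd_term -scalemxAr -scalemxAl; congr (_ *: _).
    rewrite !mulmxA -[_ *m col i' U]mulmxA colE// eqxx mulmx1.
    by rewrite -[_ *m col i' V]mulmxA colE// eqxx mulmx1.
  rewrite /svd_term -scalemxAr -scalemxAl !mulmxA -[_ *m col j U]mulmxA colE//.
  by rewrite eq_sym (negPf ji) -scalemx1 scale0r mulmx0 !mul0mx scaler0.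
apply: (le_trans (submult_normM N_norm _ _)).
rewrite mulrAC ler_pM//; last exact: col1.
apply: (le_trans (submult_normM N_norm _ _)).
by rewrite ler_wpM2r// col1.
Qed.

End SubmultNorm.

(** * Factorization and trace of a rank-one approximation *)

Lemma rank_one_approx_outer {R : realType} {n : nat} (A B : 'M[R[i]]_n) :
  rank_one_approx A B ->
  exists (x : 'cV[R[i]]_n) (y : 'rV[R[i]]_n), B = x *m y.
Proof.
case=> U [s [V [i' [_ _ ->]]]].
by exists ((s i')%:C *: col i' U), ((col i' V)^t*); rewrite -scalemxAl.
Qed.

(** The trace of [A] is the sum of the traces of its [n] singular terms, and [i'] was chosen to
    maximize their modulus. *)
Lemma normc_trace_rank_one_approx {R : realType} {n : nat} (A B : 'M[R[i]]_n) :
  rank_one_approx A B -> Normc.normc (\tr A) <= n%:R * Normc.normc (\tr B).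
Proof.
case=> U [s [V [i' [[_ _ _ _ ->] mx ->]]]].
rewrite raddf_sum; apply: (le_trans (ler_normc_sum _ _)).
rewrite mulr_natl -[X in _ *+ X](card_ord n) -sumr_const.
apply: ler_sum => i _; rewrite -lecR; exact: mx.
Qed.

Theorem corollary2 (R : realType) (n : nat)
    (N : 'M[R[i]]_n -> R) (N_norm : submult_norm N)
    (P : 'M[R[i]]_n -> 'M[R[i]]_n)
    (P_approx : forall A : 'M[R[i]]_n, rank_one_approx A (P A))
    (F : {fset 'M[R]_n})
    (F_nonneg : forall A : 'M[R]_n, A \in F -> nonneg_mx A)
    (F_prim : exists j : nat, (1 <= j)%N /\
       exists B : 'M[R]_n, B \in mprods F j /\ primitive_mx B) :
  (fun k : nat =>
     jsr N [fset P A | A in mprods (cplx_set F) k] `^ (k%:R^-1))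
    @ \oo --> jsr N (cplx_set F).
Proof.
case: F_prim => j0 [_ [B [BF [_ [l _ D0]]]]].
set D := mxpow B l in D0; set G := cplx_set F.
have DF : D \in mprods F (l * j0) by exact: mprods_pow.
set m := (l * j0)%N in DF.
pose g k := jsr N [fset P A | A in mprods G k].
have [C C0 gC] : exists2 C, 0 < C &
    forall k, g k <= C * prods_norm (N := N) G k.
  have [C C0 CN] := submult_norm_rank_one_approx N_norm.
  exists C => // k; apply: (jsr_le N_norm).
    by rewrite mulr_ge0 ?prods_norm_ge0// ltW.
  move=> _ /imfsetP[/= A AG ->]; apply: (le_trans (CN _ _ (P_approx A))).
  by rewrite ler_pM2l// le_prods_norm.
have [c c0 cg] : exists2 c, 0 < c &
    forall k, prods_norm (N := N) G k <= c * g (m + k)%N.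
  have [C1 C10 C1N] := submult_norm_le_entries N_norm.
  have [c1 c10 c1D] := entry_le_trace_mulmx _ D0.
  (* [n.+1] in place of [n] keeps the constant positive when [n = 0]. *)
  exists (C1 * (c1 * n.+1%:R)) => [|k]; first by rewrite !mulr_gt0.
  apply: prods_norm_le => [|_ /mprods_cplx[A AF ->]].
    by rewrite mulr_ge0 ?(jsr_ge0 N_norm)// ltW// !mulr_gt0.
  have A0 := mprods_nonneg F k A F_nonneg AF.
  have DA0 := mprods_nonneg F _ _ F_nonneg (mprods_mul F D A m k DF AF).
  have t0 : 0 <= \tr (D *m A) by exact: sumr_ge0.
  (* [D *m A] has length [m + k], so its rank-one approximation belongs to the family defining
     [g (m + k)]. *)
  have tg : \tr (D *m A) <= n.+1%:R * g (m + k)%N.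
    set Z := map_mx (real_complex R) (D *m A).
    have -> : \tr (D *m A) = Normc.normc (\tr Z).
      by rewrite /Z trace_map_mx normc_real.
    apply: (le_trans (normc_trace_rank_one_approx _ _ (P_approx Z))).
    rewrite ler_pM ?normc_ge0 ?ler_nat//.
    have [x [y PZ]] := rank_one_approx_outer _ _ (P_approx Z).
    rewrite PZ; apply: (le_jsr_trace_outer N_norm).
    rewrite -PZ; apply/imfsetP; exists Z => //=.
    by apply/mprods_cplx; exists (D *m A) => //; exact: mprods_mul.
  rewrite -mulrA -mulrA; apply: (@le_trans _ _ (C1 * (c1 * \tr (D *m A)))).
    apply: C1N => [|i j]; first by rewrite mulr_ge0// ltW.
    by rewrite mxE normc_real// c1D.
  by rewrite ler_pM2l// ler_pM2l.
have [d d0 dg] : exists2 d, 0 < d &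
    forall k, (m <= k)%N -> d * prods_norm (N := N) G k <= g k.
  (* The added 1 allows inversion even if the maximal norm at length [m] is 0. *)
  have K0 : 0 < c * (1 + prods_norm (N := N) G m).
    by rewrite mulr_gt0// ltr_wpDr ?prods_norm_ge0.
  exists (c * (1 + prods_norm (N := N) G m))^-1 => [|k mk].
    by rewrite invr_gt0.
  rewrite (ler_pdivrMl _ _ K0).
  (* Splitting off [m] factors leaves length [k - m], for which the previous bound involves exactly
     [g k]. *)
  have := prods_norm_submul N_norm G m (k - m); rewrite (subnKC mk) => Mk.
  apply: (le_trans Mk).
  apply: (@le_trans _ _ (prods_norm (N := N) G m * (c * g (m + (k - m))%N))).
    by rewrite ler_wpM2l ?prods_norm_ge0.
  rewrite (subnKC mk) mulrCA mulrA ler_wpM2r ?(jsr_ge0 N_norm)//.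
  by rewrite ler_wpM2l ?(ltW c0)// lerDr.
have M0 := prods_norm_ge0 (N := N) G.
have ML := jsr_cvg N_norm G.
have lower := cvg_root_scale _ _ _ d0 M0 ML.
have upper := cvg_root_scale _ _ _ C0 M0 ML.
(* Both bounding sequences tend to [jsr N G]; the lower bound holds from index [m] on. *)
apply: (squeeze_cvgr _ lower upper).
exists m => // k /= mk; apply/andP; split; apply: ler_powR_root.
- by rewrite mulr_ge0// ltW.
- exact: dg.
- exact: jsr_ge0.
- exact: gC.
Qed.
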